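(* Every outer-planar graph has property $M(3)$.
   Context: Graphs are finite, simple, with at least one vertex. A $k$-list assignment $L$ of a graph $G$ assigns to each vertex $v$ a set $L(v)$ of exactly $k$ colors. A proper $L$-list coloring is a map $c$ on $V(G)$ with $c(v)\in L(v)$ for all $v$ and $c(u)\ne c(v)$ for every edge $uv$. $G$ is uniquely $k$-list colorable (U$k$LC) if there exists a $k$-list assignment $L$ for which $G$ has exactly one proper $L$-list coloring. $G$ has property $M(k)$ if it is not uniquely $k$-list colorable. *)

(* Defs.v *)
From HB Require Import structures.
From mathcomp Require Import all_boot all_order all_algebra finmap.
From mathcomp Require Import all_classical all_reals.
From mathcomp Require Import topology normedtype.
Set Implicit Arguments.
Unset Strict Implicit.
Unset Printing Implicit Defensive.
Import Order.TTheory GRing.Theory Num.Theory.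
Import numFieldNormedType.Exports.

Local Open Scope classical_set_scope.
Local Open Scope ring_scope.

(* A finite simple graph on the vertex set T is given by its adjacency
   relation e : rel T, assumed symmetric and irreflexive. *)

Section ListColoring.
Variables (T : finType) (e : rel T).

Definition list_assignment (C : choiceType) (k : nat) (L : T -> {fset C}) :=
  forall v, #|` L v| = k.

Definition list_coloring (C : choiceType) (L : T -> {fset C})
    (c : {ffun T -> C}) :=
  (forall v, c v \in L v) /\ (forall u v, e u v -> c u != c v).

Definition uniquely_list_colorable (k : nat) :=
  exists (C : choiceType) (L : T -> {fset C}),
    list_assignment k L /\ exists! c : {ffun T -> C}, list_coloring L c.

Definition property_M (k : nat) := ~ uniquely_list_colorable k.

End ListColoring.

Section OuterPlanar.
Variable R : realType.
Local Notation plane := (R * R)%type.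

Definition arc_between (a b : plane) (A : set plane) :=
  exists g : R -> plane,
    [/\ {within `[0, 1], continuous g},
        set_inj `[0, 1] g,
        g 0 = a, g 1 = b & A = g @` `[0, 1]].

Variables (T : finType) (e : rel T).

(* A vertex v is drawn as the point p v, and an edge uv as the point set
   A [set u; v]; the values of A at finite sets that are not edges are
   irrelevant. By the third clause, the vertices lying on the arc of an edge
   are its two endpoints only, so by the fourth one two distinct edges meet at
   most in a common endpoint. *)
Definition plane_embedding (p : T -> plane) (A : {set T} -> set plane) :=
  [/\ injective p,
      forall u v, e u v -> arc_between (p u) (p v) (A [set u; v]%SET),
      forall u v w, e u v -> A [set u; v]%SET (p w) -> w = u \/ w = v
    & forall u v x y, e u v -> e x y -> [set u; v]%SET != [set x; y]%SET ->
        A [set u; v]%SET `&` A [set x; y]%SET `<=` range p].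

Definition drawing (p : T -> plane) (A : {set T} -> set plane) : set plane :=
  range p `|` [set z | exists u v, e u v /\ A [set u; v]%SET z].

Definition face (p : T -> plane) (A : {set T} -> set plane) (F : set plane) :=
  exists2 z, (~` drawing p A) z & F = connected_component (~` drawing p A) z.

Definition outer_face p A (F : set plane) :=
  face p A F /\ ~ bounded_set F.

Definition outerplanar :=
  exists p A F, [/\ plane_embedding p A, outer_face p A F
    & forall v, (closure F `\` interior F) (p v)].

End OuterPlanar.

(* Main.v *)
(** Record how a plane graph turns by integers counting half-turns: for a
    polygonal chain and a point [q], the signed number of times that the vector
    from [q] to the chain crosses the vertical axis. Join each vertex [x] to a
    far point [w] of the outer face by a chain [Q x]; it may cross the arcs at
    [x] itself, so accessibility of [x] from the face plays no role. If
    [f x v] is minus the number of half-turns of [Q x] about [v], corrected by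
    a term depending on [v] and [w] only, then [g x v = f x v - f v x] is
    antisymmetric, is odd for [x != v], and satisfies
    [g x u - g y u = g x v - g y v] for disjoint edges [xy], [uv], because the
    differences of points on two disjoint arcs form a square of nonzero
    vectors, whose boundary has total turning zero.

    Such a [g] survives edge contraction and cannot exist on a subdivided K4.
    It follows by induction that some vertex has degree at most 2 in any
    induced subgraph, and lists of size 3 then extend colorings greedily,
    which yields two colorings from a single vertex onwards. *)

Require Import Defs.
From mathcomp Require Import all_boot all_order all_algebra all_reals.
From mathcomp Require Import finmap zify ring lra.
Set Implicit Arguments.
Unset Strict Implicit.
Unset Printing Implicit Defensive.
Import Order.TTheory GRing.Theory Num.Theory.
Local Open Scope ring_scope.

(** * Noncrossing systems, edge contraction and vertices of low degree *)

Definition noncrossing (T : finType) (g : T -> T -> int) (S : {set T})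
    (e : rel T) :=
  forall x y u v, x \in S -> y \in S -> u \in S -> v \in S ->
    e x y -> e u v -> x != u -> x != v -> y != u -> y != v ->
    g x u - g y u = g x v - g y v.

Definition neighbors (T : finType) (S : {set T}) (e : rel T) (x : T) :=
  [set y in S | e x y].

Section LowDegree.
Variables (T : finType) (g : T -> T -> int).
Hypothesis g_anti : forall x y, g x y = - g y x.
Hypothesis g_odd : forall x y, x != y -> exists k, g x y = k * 2 + 1.

(** The merged vertex keeps the name [r], so [g] need not change; [s] is discarded by passing to
    [S :\ s]. *)
Definition contract (e : rel T) (s r : T) : rel T :=
  fun x y => (x != y) &&
    [|| e x y, (x == r) && e s y | (y == r) && e s x].

Lemma noncrossing_sub (S S' : {set T}) (e : rel T) :
  S' \subset S -> noncrossing g S e -> noncrossing g S' e.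
Proof.
move=> /subsetP sS ncr x y u v xS yS uS vS.
by apply: ncr; apply: sS.
Qed.

(** A new edge from [r] to [v] stands for the path through [s] in [e]. Both edges of that path are
    disjoint from the opposite edge, so their relations add up. *)
Lemma noncrossing_contract (S : {set T}) (e : rel T) (r s : T) :
  symmetric e -> r \in S -> s \in S -> e r s ->
  noncrossing g S e -> noncrossing g (S :\ s) (contract e s r).
Proof.
move=> e_sym rS sS rs ncr.
have half x y u v : x \in S -> y \in S -> u \in S :\ s -> v \in S :\ s ->
    e x y -> contract e s r u v -> x != s -> y != s ->
    x != u -> x != v -> y != u -> y != v ->
    g x u - g y u = g x v - g y v.
  move=> xS yS /setD1P[us uS] /setD1P[vs vS] xy /andP[_ uv] xs ys xu xv yu yv.
  case/or3P: uv => [uv|/andP[/eqP ur sv]|/andP[/eqP vr su]].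
  - exact: (ncr x y u v).
  - rewrite ur in xu yu *.
    by rewrite (ncr x y r s) // (ncr x y s v).
  - rewrite vr in xv yv *.
    by rewrite -(ncr x y s r) ?(ncr x y s u) // e_sym.
move=> x y u v /setD1P[xs xS] /setD1P[ys yS] uS vS /andP[_ xy].
move=> uv xu xv yu yv.
have [us uS'] := setD1P uS; have [vs vS'] := setD1P vS.
case/or3P: xy => [xy|/andP[/eqP xr sy]|/andP[/eqP yr sx]]; first exact: half.
(* Two new edges would share [r], so the edge opposite to a new one belongs to [e]. *)
all: have uv' : e u v.
all: try by case/andP: uv => _ /or3P[//|/andP[/eqP ur _]|/andP[/eqP vr _]];
  rewrite ?ur ?vr ?xr ?yr eqxx in xu xv yu yv.
- rewrite xr in xu xv *.
  have := ncr r s u v rS sS uS' vS' rs uv' xu xv; rewrite ![s == _]eq_sym.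
  have := ncr s y u v sS yS uS' vS' sy uv'; rewrite ![s == _]eq_sym.
  move=> /(_ us vs yu yv) A /(_ us vs) B; clear -A B; lia.
- rewrite yr in yu yv *.
  have := ncr r s u v rS sS uS' vS' rs uv' yu yv; rewrite ![s == _]eq_sym.
  have := ncr s x u v sS xS uS' vS' sx uv'; rewrite ![s == _]eq_sym.
  move=> /(_ us vs xu xv) A /(_ us vs) B; clear -A B; lia.
Qed.

(** Each edge of a path inside [A] is disjoint from [xy], so [g x - g y] takes equal values at its
    ends. *)
Lemma noncrossing_connect (S A : {set T}) (e : rel T) (x y u v : T) :
  noncrossing g S e -> A \subset S -> x \in S -> y \in S -> e x y ->
  x \notin A -> y \notin A ->
  u \in A -> connect [rel a b | [&& e a b, a \in A & b \in A]] u v ->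
  v \in A /\ g x u - g y u = g x v - g y v.
Proof.
move=> ncr /subsetP AS xS yS xy xA yA uA /connectP[s ps ->] {v}.
elim: s u uA ps => [|b s IH] u uA //= /andP[/and3P[ub _ bA] ps].
have [lA <-] := IH b bA ps; split=> //.
by apply: ncr (AS _ _) (AS _ _) xy ub _ _ _ _ => //;
  [apply: contraNneq xA|apply: contraNneq xA|apply: contraNneq yA|
   apply: contraNneq yA] => ->.
Qed.

(* A subdivided [K4] with branch vertices [r], [s], [y], [z]: adding up the
   noncrossing relations of its three pairs of opposite edges makes a sum of
   three odd numbers vanish. *)
Lemma noncrossing_no_K4 (S A : {set T}) (e : rel T) (r s y z a b : T) :
  symmetric e -> noncrossing g S e -> A \subset S ->
  r \in S -> s \in S -> y \in S -> z \in A ->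
  r \notin A -> s \notin A -> y \notin A -> r != s -> y != r -> y != s ->
  e r s -> e y r -> e y s -> e y z -> e a r -> e b s ->
  connect [rel a b | [&& e a b, a \in A & b \in A]] z a ->
  connect [rel a b | [&& e a b, a \in A & b \in A]] z b -> False.
Proof.
move=> e_sym ncr AS rS sS yS zA rA sA yA nrs nyr nys rs yr ys yz ar bs za zb.
have zS := subsetP AS _ zA.
have outA q q' : q \notin A -> q' \in A -> q != q'.
  by move=> qA q'A; apply: contraNneq qA => ->.
have ry : e r y by rewrite e_sym.
have sy : e s y by rewrite e_sym.
have [aA Ea] := noncrossing_connect ncr AS sS yS sy sA yA zA za.
have [bA Eb] := noncrossing_connect ncr AS rS yS ry rA yA zA zb.
have nsr : s != r by rewrite eq_sym.
have nry : r != y by rewrite eq_sym.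
have nsy : s != y by rewrite eq_sym.
have E1 : g r y - g s y = g r z - g s z.
  by apply: (ncr r s y z) => //; apply: outA.
have E2 : g s a - g y a = g s r - g y r.
  by apply: (ncr s y a r) => //; [apply: (subsetP AS)|apply: outA|apply: outA].
have E3 : g r b - g y b = g r s - g y s.
  by apply: (ncr r y b s) => //; [apply: (subsetP AS)|apply: outA|apply: outA].
have [k1 K1] := g_odd nrs; have [k2 K2] := g_odd nyr; have [k3 K3] := g_odd nys.
have := g_anti r s; have := g_anti y r; have := g_anti y s.
have := g_anti y z; clear -E1 E2 E3 Ea Eb K1 K2 K3; lia.
Qed.

(** Contraction lowers the degree of [y] only by identifying its neighbors [r] and [s]; the second
    alternative describes this case, with one further neighbor [z]. *)
Lemma neighbors_contract (S : {set T}) (e : rel T) (r s y : T) :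
  symmetric e -> irreflexive e -> r \in S -> e r s -> y != r -> y != s ->
  (#|neighbors (S :\ s) (contract e s r) y| <= 2)%N ->
  (#|neighbors S e y| <= 2)%N \/
  [/\ e y r, e y s & exists2 z, z \in S :\: [set r; s; y] &
      e y z /\ neighbors S e y \subset [set r; s; z]].
Proof.
move=> e_sym e_irr rS rs nyr nys deg; set Ne := neighbors S e y.
set Nc := neighbors _ _ y in deg.
have nrs : r != s by apply: contraTneq rs => ->; rewrite e_irr.
have Nsub : Ne :\ s \subset Nc.
  apply/subsetP => z /setD1P[zs]; rewrite !inE zs => /andP[-> yz] /=.
  by rewrite /contract yz andbT; apply: contraTneq yz => ->; rewrite e_irr.
have [ys|ys] := boolP (e y s); last first.
  left; apply: leq_trans deg; apply/subset_leq_card/subsetP => z zN.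
  apply: (subsetP Nsub); rewrite in_setD1 zN andbT.
  by apply: contraNneq ys => <-; move: zN; rewrite inE => /andP[].
have rN : r \in Nc.
  by rewrite !inE nrs rS /contract nyr eqxx (e_sym s y) ys !orbT.
(* In the quotient [r] is one of at most two neighbors of [y], which leaves at most one outside [r]
   and [s]. *)
have degD : (#|Ne :\: [set r; s]| <= 1)%N.
  have : (#|Nc :\ r| <= 1)%N by move: deg; rewrite (cardsD1 r Nc) rN.
  apply: leq_trans; apply/subset_leq_card/subsetP => z.
  rewrite !in_setD in_set2 in_set1 negb_or => /andP[/andP[-> zs] zN] /=.
  by apply: (subsetP Nsub); rewrite in_setD1 zs.
have NeE : Ne \subset [set r; s] :|: (Ne :\: [set r; s]).
  by apply/subsetP => z; rewrite in_setU in_setD => ->; rewrite andbT orbN.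
have [D0|[z zD]] := set_0Vmem (Ne :\: [set r; s]).
  left; rewrite D0 setU0 in NeE.
  apply: (@leq_trans #|[set r; s]|); first exact: subset_leq_card.
  by rewrite cards2 ltnS leq_b1.
have zE : Ne :\: [set r; s] = [set z].
  by apply/eqP; rewrite eq_sym eqEcard sub1set zD cards1.
have [yr|yr] := boolP (e y r).
  right; split=> //; exists z.
    move: zD; rewrite !inE !negb_or => /and3P[-> -> yz]; rewrite !andbT /=.
    by apply: contraTneq yz => ->; rewrite e_irr.
  split; first by move: zD; rewrite !inE => /and3P[].
  by move: NeE; rewrite zE.
left; apply: (@leq_trans #|[set s; z]|); last by rewrite cards2 ltnS leq_b1.
apply/subset_leq_card/subsetP => q qN.
move: (subsetP NeE q qN); rewrite zE !inE => /orP[/orP[/eqP qr|->//]|->].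
  by move: qN; rewrite qr inE (negPf yr) andbF.
by rewrite orbT.
Qed.

(* Allowing the clique [r, s] to have any degree is what makes the induction
   go through. Contract [s] into [r]: a vertex [y] of degree at most 2 in the
   quotient has degree at most 2, or neighbors [r], [s] and one more, [z]. In
   the latter case the component of [z] outside [r, s, y] misses [r] or [s]
   for lack of a K4, and the induction hypothesis applies to it, rooted at
   [y] and the remaining one of [r] and [s]. *)
Lemma low_degree_rooted (n : nat) (S : {set T}) (e : rel T) (r s : T) :
  (#|S| <= n)%N -> symmetric e -> irreflexive e -> noncrossing g S e ->
  r \in S -> s \in S -> (r = s \/ e r s) ->
  (exists x, x \in S :\: [set r; s]) ->
  exists2 x, x \in S :\: [set r; s] & (#|neighbors S e x| <= 2)%N.
Proof.
elim: n S e r s => [|n IH] S e r s.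
  by rewrite leqn0 cards_eq0 => /eqP-> _ _ _; rewrite inE.
move=> leSn e_sym e_irr ncr rS sS rs exx.
have le_n (S' : {set T}) q : q \in S -> S' \subset S :\ q -> (#|S'| <= n)%N.
  move=> qS SS; apply: (@leq_trans #|S :\ q|).
    exact: subset_leq_card.
  by move: leSn; rewrite (cardsD1 q) qS.
have edge r' s' : r' \in S -> s' \in S -> e r' s' ->
    (exists x, x \in S :\: [set r'; s']) ->
    exists2 x, x \in S :\: [set r'; s'] & (#|neighbors S e x| <= 2)%N.
  move: r' s' => {rS sS rs exx} {}r {}s rS sS rs [x0 x0S].
  have nrs : r != s by apply: contraTneq rs => ->; rewrite e_irr.
  have [|||||y] := IH (S :\ s) (contract e s r) r r (le_n _ _ sS (subxx _)) _ _
    (noncrossing_contract e_sym rS sS rs ncr) _ _ (or_introl erefl) _.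
  - move=> x y; rewrite /contract eq_sym e_sym; congr (_ && (_ || _)).
    by rewrite orbC.
  - by move=> x; rewrite /contract eqxx.
  - by rewrite !inE nrs.
  - by rewrite !inE nrs.
  - exists x0; move: x0S; rewrite !inE !negb_or andbb.
    by case/andP=> /andP[-> ->] ->.
  rewrite !inE orbb => /and3P[nyr nys yS].
  case/(neighbors_contract e_sym e_irr rS rs nyr nys) => [deg|].
    by exists y => //; rewrite !inE negb_or nyr nys.
  case=> yr ys [z zA [yz Ny]].
  set A := S :\: [set r; s; y] in zA.
  have AS : A \subset S by apply: subsetDl.
  pose c := connect [rel a b | [&& e a b, a \in A & b \in A]] z.
  have cA b : c b -> b \in A.
    move/connectP=> [p]; elim: p z zA {c yz Ny} => [|a p IHp] z zA /=.
      by move=> _ ->.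
    by case/andP=> /and3P[_ _ aA] pa; apply: IHp aA pa.
  (* Here [r'], [s'] are [r], [s] in some order, and the component [c] of [z] has no edge to [s'].
     Adding [r'] and [y] to [c] gives a set smaller than [S] that contains all neighbors in [S] of
     vertices of [c]. *)
  have half r' s' : r' \in S -> s' \in S -> e y r' -> s' != r' -> s' != y ->
      [set r'; s'; y] = [set r; s; y] ->
      (forall b, c b -> ~~ e b s') ->
      exists2 x, x \in S :\: [set r; s] & (#|neighbors S e x| <= 2)%N.
    move=> r'S s'S yr' nrs' nys' ES noS.
    have ES' q : [|| q == r', q == s' | q == y] = [|| q == r, q == s | q == y].
      by move/setP/(_ q): ES; rewrite !inE -!orbA.
    have AE q : (q \in A) = ~~ [|| q == r', q == s' | q == y] && (q \in S).
      by rewrite ES' !inE -!orbA.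
    pose B := [set q | c q] :|: [set r'; y].
    have BS : B \subset S.
      apply/subsetP => q; rewrite !inE => /or3P[/cA/(subsetP AS)//|/eqP->//|].
      by move/eqP->.
    have BSs : B \subset S :\ s'.
      apply/subsetP => q qB; rewrite in_setD1 (subsetP BS) // andbT.
      apply: contraTneq qB => ->; rewrite !inE !negb_or nrs' nys' !andbT.
      by apply/negP => /cA; rewrite AE eqxx orbT.
    have [||||x] := IH B e r' y (le_n _ _ s'S BSs) e_sym e_irr
      (noncrossing_sub BS ncr).
    - by rewrite !inE eqxx orbT.
    - by rewrite !inE eqxx !orbT.
    - by right; rewrite e_sym.
    - exists z; move: (zA); rewrite AE !inE !negb_or.
      case/andP=> /and3P[-> _ ->] _.
      by rewrite /c connect0.
    move=> xB deg; have {xB} cx : c x.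
      by move: xB; rewrite !inE; case: (c x) => //=; case: (_ || _).
    exists x.
      by move: (cA _ cx); rewrite !inE !negb_or -!andbA => /and4P[-> -> _ ->].
    apply: leq_trans deg; apply/subset_leq_card/subsetP => q.
    rewrite !inE => /andP[qS xq]; rewrite xq andbT.
    have [cq|ncq] /= := boolP (c q); first by [].
    have qs' : q != s' by apply: contraTneq xq => ->; apply: noS.
    apply: contraNT ncq; rewrite negb_or => /andP[qr' qy].
    have qA : q \in A by rewrite AE !negb_or qr' qs' qy.
    apply: (connect_trans cx (connect1 _)).
    by rewrite /= xq qA (cA _ cx).
  have [/existsP[a /andP[ca ar]]|nor] := boolP [exists a, c a && e a r].
    have [/existsP[b /andP[cb bs]]|nos] := boolP [exists b, c b && e b s].
      have rA : r \notin A by rewrite !inE eqxx.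
      have sA : s \notin A by rewrite !inE eqxx orbT.
      have yA : y \notin A by rewrite !inE eqxx !orbT.
      by case: (noncrossing_no_K4 e_sym ncr AS rS sS yS zA rA sA yA nrs nyr nys
        rs yr ys yz ar bs ca cb).
    apply: (half r s) => //; [by rewrite eq_sym|by rewrite eq_sym|move=> b cb].
    apply: contraNN nos => bs.
    by apply/existsP; exists b; rewrite cb.
  apply: (half s r) => //; first by rewrite eq_sym.
    by rewrite [[set s; r]]setUC.
  move=> b cb; apply: contraNN nor => br.
  by apply/existsP; exists b; rewrite cb.
case: rs => [rs|rs]; last exact: edge.
rewrite -{s sS}rs in exx *.
(* A single root with a neighbor is replaced by an edge at it; an isolated root is deleted, which
   changes no other degree. *)
have [/existsP[s /andP[sS rs]]|nors] := boolP [exists s, (s \in S) && e r s].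
  have nrs : s != r by apply: contraTneq rs => ->; rewrite e_irr.
  have [D0|[x xD]] := set_0Vmem (S :\: [set r; s]).
    exists s; first by rewrite !inE orbb nrs.
    apply: (@leq_trans #|[set r; s]|); last by rewrite cards2 ltnS leq_b1.
    apply/subset_leq_card; apply: subset_trans (_ : S \subset _).
      by apply/subsetP => q; rewrite inE => /andP[].
    by rewrite -setD_eq0 D0.
  have [|y yD deg] := edge r s rS sS rs; first by exists x.
  exists y => //; move: yD; rewrite !inE !negb_or => /andP[/andP[-> _] ->].
  by [].
have [x xD] := exx; have [nxr xS] : x != r /\ x \in S.
  by move: xD; rewrite !inE orbb => /andP[].
have [D0|[x' x'D]] := set_0Vmem (S :\: [set r; x]).
  exists x => //; apply: (@leq_trans #|[set r; x]|).
    apply/subset_leq_card; apply: subset_trans (_ : S \subset _).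
      by apply/subsetP => q; rewrite inE => /andP[].
    by rewrite -setD_eq0 D0.
  by rewrite cards2 ltnS leq_b1.
have [||||y] := IH (S :\ r) e x x (le_n _ _ rS (subxx _)) e_sym e_irr
  (noncrossing_sub (subsetDl _ _) ncr).
- by rewrite !inE nxr.
- by rewrite !inE nxr.
- by left.
- exists x'; move: x'D; rewrite !inE !negb_or.
  by case/andP=> /andP[-> ->] ->.
rewrite !inE orbb => /and3P[nyx nyr yS] deg.
exists y; first by rewrite !inE negb_or nyr.
apply: leq_trans deg; apply/subset_leq_card/subsetP => q.
rewrite !inE => /andP[qS yq]; rewrite qS yq !andbT.
apply: contraNneq nors => qr; apply/existsP; exists y.
by rewrite yS e_sym -qr.
Qed.

Lemma noncrossing_low_degree (S : {set T}) (e : rel T) :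
  symmetric e -> irreflexive e -> noncrossing g S e -> S != set0 ->
  exists2 x, x \in S & (#|neighbors S e x| <= 2)%N.
Proof.
move=> e_sym e_irr ncr /set0Pn[r rS].
have [D0|[x xD]] := set_0Vmem (S :\: [set r; r]).
  exists r => //; apply: (@leq_trans #|[set r; r]|).
    apply/subset_leq_card; apply: subset_trans (_ : S \subset _).
      by apply/subsetP => q; rewrite inE => /andP[].
    by rewrite -setD_eq0 D0.
  by rewrite cards2 ltnS leq_b1.
have [||y] := low_degree_rooted (leqnn _) e_sym e_irr ncr rS rS.
- by left.
- by exists x.
by rewrite inE => /andP[_ yS]; exists y.
Qed.

End LowDegree.

(** * Greedy list coloring *)

Section Coloring.
Variables (T : finType) (e : rel T) (C : choiceType) (L : T -> {fset C}).
Hypothesis e_sym : symmetric e.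
Hypothesis e_irr : irreflexive e.
Hypothesis L3 : forall v, #|` L v| = 3%N.

(** Partial colorings are total functions, arbitrary off [S], so that an extension changes a single
    value. *)
Definition colors (S : {set T}) (c : T -> C) :=
  (forall v, v \in S -> c v \in L v) /\
  (forall u v, u \in S -> v \in S -> e u v -> c u != c v).

(** The neighbors of [x] exclude at most two of three colors. The explicit form shows that colorings
    which differ on [S :\ x] still differ once extended. *)
Lemma colors_extend (S : {set T}) (x : T) (c : T -> C) :
  x \in S -> (#|neighbors S e x| <= 2)%N -> colors (S :\ x) c ->
  exists a, colors S (fun v => if v == x then a else c v).
Proof.
move=> xS deg [cL ce].
pose N := [seq c v | v <- enum (neighbors S e x)].
have [a aL aN] : exists2 a, a \in L x & a \notin N.
  apply/hasP; rewrite -[has _ _]negbK -all_predC; apply/negP => /allP LN.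
  have sub : {subset (L x : seq C) <= N} by move=> b /LN /= /negbNE.
  have := uniq_leq_size (fset_uniq (L x)) sub.
  by rewrite [size (L x)]L3 size_map -cardE => /leq_trans/(_ deg).
exists a; split=> [v vS|].
  by case: eqVneq => [->//|vx]; apply: cL; rewrite !inE vx.
have aP v : v \in S -> e x v -> a != c v.
  move=> vS xv; apply: contraNneq aN => ->; apply: map_f.
  by rewrite mem_enum inE vS.
move=> u v uS vS; case: (eqVneq u x) => [->|ux].
  case: (eqVneq v x) => [->|vx]; first by rewrite e_irr.
  exact: aP.
case: (eqVneq v x) => [->|vx] uv; last by apply: ce; rewrite // !inE ?ux ?vx.
by rewrite eq_sym aP // e_sym.
Qed.

Hypothesis e_degenerate : forall S : {set T}, S != set0 ->
  exists2 x, x \in S & (#|neighbors S e x| <= 2)%N.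

Lemma two_colorings (S : {set T}) : S != set0 ->
  exists c1 c2, [/\ colors S c1, colors S c2 &
    exists2 v, v \in S & c1 v != c2 v].
Proof.
have [n] := ubnP #|S|; elim: n S => // n IH S leSn S0.
have [x xS deg] := e_degenerate S0.
have [S1|S1] := eqVneq (S :\ x) set0.
  have Sx v : v \in S -> v = x.
    move=> vS; apply/eqP/negbNE/negP => vx.
    by have := in_set0 v; rewrite -S1 !inE vx vS.
  (* On a single vertex, two colors of its list give two colorings. *)
  have [a [b [aL bL ab]]] : exists a b, [/\ a \in L x, b \in L x & a != b].
    have /fset0Pn[a aL] : L x != fset0 by rewrite -cardfs_gt0 L3.
    have /fset0Pn[b] : (L x `\ a)%fset != fset0.
      rewrite -cardfs_gt0; move: (L3 x).
      by rewrite (cardfsD1 a) aL add1n => -[->].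
    by rewrite in_fsetD1 eq_sym => /andP[ab bL]; exists a, b.
  exists (fun=> a), (fun=> b); split; last by exists x.
  - split=> [v /Sx->//|u v /Sx-> /Sx->]; by rewrite e_irr.
  - split=> [v /Sx->//|u v /Sx-> /Sx->]; by rewrite e_irr.
have [|c1 [c2 [C1 C2 [v vS vc]]]] := IH (S :\ x) _ S1.
  by move: leSn; rewrite (cardsD1 x) xS.
have [a1 H1] := colors_extend xS deg C1.
have [a2 H2] := colors_extend xS deg C2.
do 2!eexists; split; [exact: H1|exact: H2|exists v].
  by move: vS; rewrite inE => /andP[].
by move: vS; rewrite !inE => /andP[/negPf-> _].
Qed.

End Coloring.

Lemma noncrossing_property_M (T : finType) (g : T -> T -> int) (e : rel T) :
  (forall x y, g x y = - g y x) ->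
  (forall x y, x != y -> exists k, g x y = k * 2 + 1) ->
  (0 < #|T|)%N -> symmetric e -> irreflexive e ->
  noncrossing g [set: T] e -> property_M e 3.
Proof.
move=> g_anti g_odd T_gt0 e_sym e_irr ncr [C [L [L3 [c [_ c_uniq]]]]].
have degenerate (S : {set T}) : S != set0 ->
    exists2 x, x \in S & (#|neighbors S e x| <= 2)%N.
  apply: (noncrossing_low_degree g_anti g_odd e_sym e_irr).
  exact: noncrossing_sub (subsetT S) ncr.
have [|c1 [c2 [C1 C2 [v _ c12]]]] :=
  two_colorings e_sym e_irr L3 degenerate (S := [set: T]).
  by rewrite -card_gt0 cardsT.
have colorsE d : colors e L [set: T] d -> c = [ffun v => d v].
  by move=> [dL de]; apply: c_uniq; split=> [u|u w]; rewrite !ffunE; auto.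
have /ffunP/(_ v) := etrans (esym (colorsE c1 C1)) (colorsE c2 C2).
by rewrite !ffunE => /eqP; apply/negP.
Qed.

From mathcomp Require Import all_classical topology normedtype.
Import numFieldNormedType.Exports.
Local Open Scope classical_set_scope.
Local Open Scope ring_scope.

(** * Distance, compactness and connectedness in normed spaces *)

Section Metric.
Variables (R : realType) (V : normedModType R).

Lemma closed_dist (K : set V) (x : V) :
  closed K -> ~ K x -> exists2 r : R, 0 < r & forall y, K y -> r <= `|y - x|.
Proof.
move=> Kc Kx; have /nbhs_normP[r /= r0 rP] : \forall y \near x, ~ K y.
  exact: open_nbhs_nbhs (conj (closed_openC Kc) Kx).
exists r => // y Ky; rewrite leNgt; apply/negP => yx.
by apply: (rP y) Ky; rewrite /ball_ /= distrC.
Qed.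

(** Points near [x] inherit half of the distance from [x] to [B]; compactness makes such a local
    bound uniform. *)
Lemma compact_closed_dist (A B : set V) :
  compact A -> closed B -> A `&` B = set0 ->
  exists2 r : R, 0 < r & forall a b, A a -> B b -> r <= `|a - b|.
Proof.
move=> /compact_near_coveringP Ac Bc AB0.
have : \forall r \near (0 : R)^'+,
    A `<=` (fun a => forall b, B b -> r <= `|a - b|).
  apply: Ac => x Ax.
  have nBx : ~ B x by move=> Bx; have : (A `&` B) x by []; rewrite AB0.
  have [r r0 rP] := closed_dist Bc nBx.
  have h0 : 0 < r / 2 by lra.
  near=> y d => b Bb /=.
  have dr : d <= r / 2 by near: d; exact: nbhs_right_le.
  have yr : `|x - y| < r / 2 by near: y; exact: cvgr_dist_lt.
  have := rP b Bb; have := ler_distD y b x.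
  rewrite (distrC b y) (distrC y x); lra.
move=> rP; have : \forall r \near (0 : R)^'+,
    0 < r /\ A `<=` [set a | forall b, B b -> r <= `|a - b|].
  by near=> r; split; [near: r; exact: nbhs_right_gt|near: r].
by case/filter_ex => r [r0 {}rP]; exists r => // a b /rP; apply.
Unshelve. all: by end_near. Qed.

(** Serves to choose one margin for all vertices and all pairs of edges. *)
Lemma uniform_small (I : finType) (P : I -> R -> Prop) :
  (forall i d d', 0 < d' -> d' <= d -> P i d -> P i d') ->
  (forall i, exists2 d, 0 < d & P i d) -> exists2 d, 0 < d & forall i, P i d.
Proof.
move=> P_le P_ex.
have : \forall d \near (0 : R)^'+, forall i, P i d.
  apply: filter_forall => i; have [d d0 Pd] := P_ex i.
  near=> d'; have d'0 : 0 < d' by near: d'; exact: nbhs_right_gt.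
  have d'd : d' <= d by near: d'; exact: nbhs_right_le.
  exact: P_le Pd.
move=> Pnear; have : \forall d \near (0 : R)^'+, 0 < d /\ forall i, P i d.
  by near=> d; split; [near: d; exact: nbhs_right_gt|near: d].
by case/filter_ex => d [d0 Pd]; exists d.
Unshelve. all: by end_near. Qed.

Lemma bounded_bigcup (I : finType) (D : set I) (F : I -> set V) :
  (forall i, D i -> compact (F i)) ->
  exists M : R, forall z, (\bigcup_(i in D) F i) z -> `|z| <= M.
Proof.
move=> Fc.
have : \forall M \near +oo, forall i : I, D i -> forall z, F i z -> `|z| <= M.
  apply: filter_forall => i; have [Di|nDi] := pselect (D i); last first.
    by apply: nearW => M /nDi.
  have [M0 [M0r MP]] := compact_bounded (Fc i Di).
  by exists M0; split=> // M M0M _ z Fz; exact: (MP M M0M z Fz).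
by case/filter_ex => M MP; exists M => z [i Di Fz]; apply: MP Fz.
Unshelve. all: by end_near. Qed.

(** Propagation in both directions makes [P] and its negation relatively open in [A]. *)
Lemma connected_locally_constant (A : set V) (P : V -> Prop) (x y : V) :
  connected A ->
  (forall a, A a -> exists2 r : R, 0 < r &
     forall b, A b -> `|b - a| < r -> P a -> P b) ->
  (forall a, A a -> exists2 r : R, 0 < r &
     forall b, A b -> `|b - a| < r -> P b -> P a) ->
  A x -> P x -> A y -> P y.
Proof.
move=> Ac PU PL Ax Px Ay.
pose near_set (Q : V -> Prop) := \bigcup_(a in [set a | A a /\ Q a])
  \bigcup_(r in [set r : R | forall b, A b -> `|b - a| < r -> Q b]) ball a r.
have near_open Q : open (near_set Q).
  by apply: bigcup_open => a _; apply: bigcup_open => r _; exact: ball_open.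
have near_setE (Q : V -> Prop) : (forall a, A a -> exists2 r : R, 0 < r &
    forall b, A b -> `|b - a| < r -> Q a -> Q b) ->
    A `&` near_set Q = A `&` [set a | Q a].
  move=> QU; apply/seteqP; split=> [b [Ab [a _ [r rQ ab]]]|b [Ab Qb]].
    by split=> //; apply: rQ => //; move: ab;
    rewrite -ball_normE /ball_ /= distrC.
  split=> //; exists b => //; have [r r0 rP] := QU b Ab.
  by exists r => [c Ac' cb|]; [exact: rP|exact: ballxx].
suff: A `&` [set a | P a] = A by move=> /seteqP[_ /(_ y Ay)[]].
apply: Ac.
- by exists x.
- by exists (near_set P) => //; rewrite near_setE.
- exists (~` near_set (fun a => ~ P a)); first exact: open_closedC.
  have := near_setE (fun a => ~ P a).
  have nPU : forall a, A a -> exists2 r : R, 0 < r &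
      forall b, A b -> `|b - a| < r -> ~ P a -> ~ P b.
    move=> a Aa; have [r r0 rP] := PL a Aa.
    by exists r => // b Ab ba nPa Pb; apply: nPa; apply: rP Pb.
  move=> /(_ nPU) E; apply/seteqP; split=> [a [Aa Pa]|a [Aa na]].
    split=> // na; have : (A `&` near_set (fun a => ~ P a)) a by [].
    by rewrite E => -[_]; apply.
  split=> //; apply: contrapT => nPa.
  have : (A `&` [set a | ~ P a]) a by [].
  by rewrite -E => -[_].
Qed.

End Metric.

(** * Chains: paths for relations valued in [Prop] *)

Section Chain.
Variables (V : Type) (P : V -> V -> Prop).

Fixpoint chain (x : V) (s : seq V) : Prop :=
  if s is y :: s' then P x y /\ chain y s' else True.

Lemma chain_rcons x s y :
  chain x s -> P (last x s) y -> chain x (rcons s y).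
Proof. by elim: s x => [|z s IH] x //= [xz zs] sy; split=> //; apply: IH. Qed.

End Chain.

Lemma sub_chain (V : Type) (P Q : V -> V -> Prop) (x : V) (s : seq V) :
  (forall a b, P a b -> Q a b) -> chain P x s -> chain Q x s.
Proof. by move=> PQ; elim: s x => [|y s IH] x //= [/PQ xy /IH]. Qed.

(** * Half-turns of polygonal chains *)

Section Turns.
Variable R : realType.
Local Notation plane := (R * R)%type.
Implicit Types (u v a b q x : plane) (s t : seq plane).

(** Only the upper half of the vertical axis counts as right, so that exactly one of two opposite
    nonzero vectors has side 1. *)
Definition side (u : plane) : int :=
  if (0 < u.1) || (u.1 == 0) && (0 < u.2) then 1 else 0.

(* Only meaningful for [u] and [v] in a common open coordinate half-plane: the
   change of argument is then less than a half-turn. *)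
Definition half_turns (u v : plane) : int :=
  if (0 < u.2) && (0 < v.2) then side u - side v
  else if (u.2 < 0) && (v.2 < 0) then side v - side u else 0.

Definition half_plane (c r : bool) (u : plane) : bool :=
  0 < (-1) ^+ r * (if c then u.1 else u.2).

Lemma sideN u : u != 0 -> side (- u) = 1 - side u.
Proof.
case: u => u1 u2; rewrite /side /= -[0]/((0 : R), (0 : R)) xpair_eqE.
rewrite !oppr_gt0 oppr_eq0.
by case: (ltgtP u1 0) => //= _; case: (ltgtP u2 0).
Qed.

Lemma half_turnsN u v : half_turns (- u) (- v) = half_turns u v.
Proof.
rewrite /half_turns /= !oppr_gt0 !oppr_lt0.
have N0 w : w.2 != 0 -> side (- w) = 1 - side w.
  by move=> w2; apply: sideN; apply: contraNneq w2 => ->.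
case: (ltgtP u.2 0) => // u0; case: (ltgtP v.2 0) => //= v0.
  by rewrite !N0 ?lt_eqF //; lia.
by rewrite !N0 ?gt_eqF //; lia.
Qed.

(** The argument is single-valued on a half-plane. The potential is [side], negated on the upper
    half-plane, where a counterclockwise crossing goes from side 1 to side 0. *)
Lemma half_turns_potential c r : exists psi : plane -> int,
  (forall u, exists k, psi u = side u + k * 2) /\
  (forall u v, half_plane c r u -> half_plane c r v ->
     half_turns u v = psi v - psi u).
Proof.
exists (fun u => (if ~~ c && ~~ r then -1 else 1) * side u).
split=> [u|[u1 u2] [v1 v2]].
  by case: (~~ c && ~~ r); [exists (- side u)|exists 0]; lia.
rewrite /half_plane /half_turns /side /=.
case: c r => [] [] /=; rewrite ?expr0 ?expr1 ?mul1r ?mulN1r ?oppr_gt0 => uH vH.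
- rewrite !(lt_gtF uH, lt_gtF vH, lt_eqF uH, lt_eqF vH) /=.
  by case: ifP => // _; case: ifP.
- by rewrite !(uH, vH) /=; case: ifP => // _; case: ifP.
- by rewrite !(uH, vH, lt_gtF uH) /=.
- by rewrite !(uH, vH) /=; do 2!case: (_ || _).
Qed.

(** In the maximum norm, a perturbation smaller than [|u|] cannot change the sign of a coordinate of
    largest absolute value. *)
Lemma half_plane_near u : exists c r,
  forall v, `|v - u| < `|u| -> half_plane c r v.
Proof.
case: u => u1 u2; exists (`|u2| <= `|u1|).
exists (if `|u2| <= `|u1| then u1 < 0 else u2 < 0).
case=> v1 v2; rewrite !prod_normE /= /half_plane gt_max !lt_max.
case: ifPn => u21.
  move=> /andP[vu _]; have {}vu : `|v1 - u1| < `|u1|.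
    by case/orP: vu => // /lt_le_trans; apply.
  have [u0|u0] := ltP u1 0; rewrite /= ?expr0 ?expr1.
    by move: vu; rewrite (ltr0_norm u0) ltr_norml; lra.
  by move: vu; rewrite (ger0_norm u0) ltr_norml; lra.
rewrite -ltNge in u21 => /andP[_ vu].
have {}vu : `|v2 - u2| < `|u2|.
  by case/orP: vu => // /lt_trans; apply.
have [u0|u0] := ltP u2 0; rewrite /= ?expr0 ?expr1.
  by move: vu; rewrite (ltr0_norm u0) ltr_norml; lra.
by move: vu; rewrite (ger0_norm u0) ltr_norml; lra.
Qed.

Fixpoint turns (q x : plane) (s : seq plane) : int :=
  if s is y :: s' then half_turns (x - q) (y - q) + turns q y s' else 0.


Definition small_square a a' b b' := exists c r, [/\ half_plane c r (a - b),
  half_plane c r (a' - b), half_plane c r (a - b') & half_plane c r (a' - b')].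

(** By the potential, both ways from [a - b] to [a' - b'] around the square have the same
    turning. *)
Lemma small_square_turns a a' b b' : small_square a a' b b' ->
  half_turns (a - b) (a' - b) + half_turns (b - a') (b' - a') =
  half_turns (b - a) (b' - a) + half_turns (a - b') (a' - b').
Proof.
move=> [c [r [H1 H2 H3 H4]]]; have [psi [_ psiE]] := half_turns_potential c r.
rewrite -(half_turnsN (b - a')) -(half_turnsN (b - a)) !opprB !psiE //. ring.
Qed.

(** A discrete Stokes formula: the identities of the cells add up, first along the row of one step
    of [s] against all of [t], then over the rows. *)
Lemma turns_square (P Q : plane -> plane -> Prop) a s b t :
  (forall a a' b b', P a a' -> Q b b' -> small_square a a' b b') ->
  chain P a s -> chain Q b t ->
  turns b a s + turns (last a s) b t = turns a b t + turns (last b t) a s.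
Proof.
move=> PQ; elim: s a => [|a' s IH] a /=; first by move=> *; rewrite add0r addr0.
move=> [aa' /IH{}IH] Qt; have {}IH := IH Qt.
suff row : half_turns (a - b) (a' - b) + turns a' b t =
    turns a b t + half_turns (a - last b t) (a' - last b t) by lia.
elim: t b {IH} Qt => [|b' t IHt] b /=; first by move=> *; rewrite addr0 add0r.
move=> [bb' /IHt{}IHt]; have := small_square_turns (PQ _ _ _ _ aa' bb'); lia.
Qed.

(** The margin [d] leaves room for a point of [K] to move by less than [d] during the step, which
    may itself be long. *)
Definition avoids (K : set plane) (d : R) b b' :=
  forall a, K a -> d + `|b' - b| <= `|a - b|.

Definition step (A : set plane) (d : R) a a' :=
  [/\ A a, A a' & `|a' - a| < d].

(** All four differences stay within [|a - b|] of [a - b]. *)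
Lemma near_small_square a a' b b' :
  `|a' - a| + `|b' - b| < `|a - b| -> small_square a a' b b'.
Proof.
move=> ab; have [c [r crP]] := half_plane_near (a - b); exists c, r.
have a0 := normr_ge0 (a' - a); have b0 := normr_ge0 (b' - b).
have E x y : x - y - (a - b) = (x - a) - (y - b).
  by rewrite !opprB addrACA [RHS]addrACA [- y - a]addrC.
split; apply: crP; rewrite E.
- by rewrite !subrr normr0; lra.
- by rewrite subrr subr0; lra.
- by rewrite subrr sub0r normrN; lra.
- by apply: le_lt_trans (ler_normB _ _) _.
Qed.

Lemma step_avoids_square (A K : set plane) (d : R) a a' b b' :
  A `<=` K -> step A d a a' -> avoids K d b b' -> small_square a a' b b'.
Proof.
move=> AK [Aa _ aa'] /(_ a (AK _ Aa)) bb'; apply: near_small_square; lra.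
Qed.

(** Each step turns by the change of a potential with the parity of [side]; the sum telescopes
    modulo 2. *)
Lemma turns_parity (K : set plane) (d : R) q b t :
  K q -> 0 < d -> chain (avoids K d) b t ->
  exists k, turns q b t = side (last b t - q) + side (b - q) + k * 2.
Proof.
move=> Kq d0; elim: t b => [|b' t IH] b /=.
  by move=> _; exists (- side (b - q)); lia.
move=> [/(_ q Kq) bb' /IH[k ->]].
have [c [r crP]] := half_plane_near (b - q).
have [psi [psi_side psiE]] := half_turns_potential c r.
have nb := normr_ge0 (b' - b); rewrite (distrC q b) in bb'.
have [k1 K1] := psi_side (b - q); have [k2 K2] := psi_side (b' - q).
exists (k + k2 - k1 + side (b' - q) - side (b - q)); rewrite psiE.
- by rewrite K1 K2; lia.
- by apply: crP; rewrite subrr normr0; lra.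
- by apply: crP; rewrite opprB addrA subrK; lra.
Qed.

Lemma connected_chain (A : set plane) (d : R) a a' :
  connected A -> 0 < d -> A a -> A a' ->
  exists2 s, chain (step A d) a s & last a s = a'.
Proof.
move=> Ac d0 Aa Aa'.
pose P b := exists2 s, chain (step A d) a s & last a s = b.
apply: (@connected_locally_constant _ _ A P a a' Ac _ _ Aa _ Aa').
- move=> b Ab; exists d => // b' Ab' bb' [s sP sb]; exists (rcons s b').
    by apply: chain_rcons; rewrite ?sb.
  by rewrite last_rcons.
- move=> b Ab; exists d => // b' Ab' bb' [s sP sb]; exists (rcons s b).
    by apply: chain_rcons; rewrite ?sb //; split; rewrite // distrC.
  by rewrite last_rcons.
- by exists [::].
Qed.

Lemma avoids_le (K : set plane) (d d' : R) b b' :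
  d' <= d -> avoids K d b b' -> avoids K d' b b'.
Proof. by move=> dd bb' a /bb'; lra. Qed.

(** Points of [F] may come arbitrarily close to [K], but a chain is finite and the least margin of
    its steps serves. *)
Lemma connected_avoiding_chain (F K : set plane) b w :
  connected F -> closed K -> F `&` K = set0 -> F b -> F w ->
  exists2 d, 0 < d & exists2 t, chain (avoids K d) b t & last b t = w.
Proof.
move=> Fc Kc FK Fb Fw.
have local c : F c -> exists2 r : R, 0 < r & forall c', `|c' - c| < r ->
    avoids K r c c' /\ avoids K r c' c.
  move=> Fc1; have nKc : ~ K c.
    by move=> Kc1; have : (F `&` K) c by []; rewrite FK.
  (* One third of [r] for the margin, one for the step, one for the distance lost when starting from
     [c']. *)
  have [r r0 rP] := closed_dist Kc nKc; exists (r / 3); first by lra.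
  move=> c' cc'; split=> a /rP ac; first by lra.
  have := ler_distD c' a c; rewrite (distrC c c'); lra.
have extend c c' r : 0 < r -> avoids K r c c' ->
    (exists2 d, 0 < d & exists2 t, chain (avoids K d) c' t & last c' t = w) ->
    exists2 d, 0 < d & exists2 t, chain (avoids K d) c t & last c t = w.
  move=> r0 cc' [d d0 [t tP tw]]; exists (Num.min r d).
    by rewrite lt_min r0.
  exists (c' :: t) => //=; split.
    by apply: avoids_le cc'; rewrite ge_min lexx.
  by apply: sub_chain tP => x y; apply: avoids_le; rewrite ge_min lexx orbT.
pose P b := exists2 d, 0 < d & exists2 t, chain (avoids K d) b t & last b t = w.
apply: (@connected_locally_constant _ _ F P w b Fc _ _ Fw _ Fb).
- move=> c Fc'; have [r r0 rP] := local c Fc'; exists r => // c' Fc'' /rP[_].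
  exact: extend.
- move=> c Fc'; have [r r0 rP] := local c Fc'; exists r => // c' Fc'' /rP[+ _].
  exact: extend.
- by exists 1 => //; exists [::].
Qed.

End Turns.

(** * From an outerplanar embedding to a noncrossing system *)

Section Main.
Variables (R : realType) (T : finType) (e : rel T).
Local Notation plane := (R * R)%type.

Section Embedding.
Variables (p : T -> plane) (A : {set T} -> set plane) (F : set plane).
Hypotheses (pA : plane_embedding e p A) (FO : outer_face e p A F).
Hypothesis pF : forall v, (closure F `\` interior F) (p v).

Local Notation D := (drawing e p A).

Lemma arc_compact u v : e u v -> compact (A [set u; v]%SET).
Proof.
case: pA => _ arcA _ _ uv; have [f [fc _ _ _ ->]] := arcA u v uv.
exact: continuous_compact fc (@segment_compact _ 0 1).
Qed.

Lemma arc_connected u v : e u v -> connected (A [set u; v]%SET).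
Proof.
case: pA => _ arcA _ _ uv; have [f [fc _ _ _ ->]] := arcA u v uv.
exact: connected_continuous_connected (@segment_connected _ 0 1) fc.
Qed.

Lemma arc_ends u v : e u v -> A [set u; v]%SET (p u) /\ A [set u; v]%SET (p v).
Proof.
case: pA => _ arcA _ _ uv; have [f [_ _ f0 f1 ->]] := arcA u v uv.
by split; [exists 0|exists 1] => //=; rewrite in_itv /= ?lexx ?ler01.
Qed.

(* The part of the drawing that an arc leaving [p x] has to avoid. *)
Definition away (x : T) : set plane :=
  \bigcup_(v in [set v | v != x]) [set p v] `|`
  \bigcup_(uv in [set uv : T * T | [/\ e uv.1 uv.2, x != uv.1 & x != uv.2]])
     A [set uv.1; uv.2]%SET.

Lemma drawingE : D = \bigcup_(v in [set: T]) [set p v] `|`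
  \bigcup_(uv in [set uv : T * T | e uv.1 uv.2]) A [set uv.1; uv.2]%SET.
Proof.
apply/seteqP; split=> z [|].
- by move=> [v _ <-]; left; exists v.
- by move=> [u [v [uv Az]]]; right; exists (u, v).
- by move=> [v _ ->]; left; exists v.
- by move=> [[u v] /= uv Az]; right; exists u, v.
Qed.

Lemma away_drawing x : away x `<=` D.
Proof.
rewrite drawingE => z [[v _ pv]|[uv [e_uv _ _] Az]]; [left|right].
  by exists v.
by exists uv.
Qed.

Lemma plane_closed1 (a : plane) : closed [set a].
Proof. exact: compact_closed (@norm_hausdorff _ _) (@compact_set1 _ _). Qed.

Lemma away_closed x : closed (away x).
Proof.
apply: closedU; apply: closed_bigcup; try exact: finite_finset.
- by move=> v _; apply: plane_closed1.
- move=> uv [/= e_uv _ _]; apply: compact_closed (@norm_hausdorff _ _) _.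
  exact: arc_compact.
Qed.

Lemma drawing_closed : closed D.
Proof.
rewrite drawingE.
apply: closedU; apply: closed_bigcup; try exact: finite_finset.
- by move=> v _; apply: plane_closed1.
- move=> uv /= e_uv; apply: compact_closed (@norm_hausdorff _ _) _.
  exact: arc_compact.
Qed.

Lemma drawing_bounded : exists M : R, forall z, D z -> `|z| <= M.
Proof.
have [M1 MP1] := @bounded_bigcup R _ T setT (fun v => [set p v])
  (fun v _ => @compact_set1 _ (p v)).
have [M2 MP2] := @bounded_bigcup R _ (T * T)%type
  [set uv | e uv.1 uv.2] (fun uv => A [set uv.1; uv.2]%SET)
  (fun uv e_uv => arc_compact e_uv).
exists (Num.max M1 M2) => z; rewrite drawingE le_max.
by case=> [/MP1->|/MP2->]; rewrite ?orbT.
Qed.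

Lemma away_vertex x : ~ away x (p x).
Proof.
case: pA => p_inj _ thirdA _; case=> [[v /= vx pxv]|[[u v] /= [uv xu xv] Ax]].
  by move: vx; rewrite (p_inj _ _ pxv) eqxx.
by case: (thirdA u v x uv Ax) => xE; rewrite xE eqxx in xu xv.
Qed.

Lemma outer_far M : exists2 w, F w & M < `|w|.
Proof.
case: FO => _ nb; apply: contrapT => nw; apply: nb.
exists M; split; first exact: num_real.
move=> M' MM' z Fz /=; rewrite leNgt; apply/negP => Mz; apply: nw.
by exists z => //; apply: lt_trans Mz.
Qed.

Lemma outer_avoids : F `<=` ~` D.
Proof. by case: FO => -[z _ ->] _; apply: connected_component_sub. Qed.

Lemma outer_connected : connected F.
Proof. by case: FO => -[z _ ->] _; apply: component_connected. Qed.

Lemma avoids_sub (K K' : set plane) (d : R) b b' :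
  K `<=` K' -> avoids K' d b b' -> avoids K d b b'.
Proof. by move=> KK bb' a /KK/bb'. Qed.

(** As [p x] lies in the closure of [F], one short jump reaches [F]; it only has to avoid [away x].
    Inside [F] the chain avoids the whole drawing. *)
Lemma vertex_chain w x : F w -> exists2 d : R, 0 < d &
  exists2 t, chain (avoids (away x) d) (p x) t & last (p x) t = w.
Proof.
move=> Fw; have [r r0 rP] := closed_dist (@away_closed x) (@away_vertex x).
have [z Fz zx] : exists2 z, F z & `|p x - z| < r / 2.
  have [cl _] := pF x; have [|z [Fz zx]] := cl (ball (p x) (r / 2)).
    by apply: nbhsx_ballx; lra.
  by exists z => //; move: zx; rewrite -ball_normE.
have FD : F `&` D = set0.
  by apply/seteqP; split=> // a [/outer_avoids].
have [d d0 [t tP tw]] :=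
  connected_avoiding_chain outer_connected drawing_closed FD Fz Fw.
exists (Num.min (r / 2) d); first by rewrite lt_min d0 andbT; lra.
exists (z :: t) => //=; split.
  move=> a /rP ar; rewrite (distrC z).
  have : Num.min (r / 2) d <= r / 2 by rewrite ge_min lexx.
  lra.
apply: sub_chain tP => a b /(avoids_sub (@away_drawing x)); apply: avoids_le.
by rewrite ge_min lexx orbT.
Qed.

Definition disjoint_edges u v x y :=
  [&& e u v, e x y, u != x, u != y, v != x & v != y].

Lemma disjoint_arcs u v x y : disjoint_edges u v x y ->
  exists2 d : R, 0 < d & forall a c, A [set u; v]%SET a ->
    A [set x; y]%SET c -> d + d <= `|a - c|.
Proof.
case: pA => p_inj _ ends crossA /and5P[uv xy ux uy /andP[vx vy]].
have [|d d0 dP] := compact_closed_dist (arc_compact uv)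
    (compact_closed (@norm_hausdorff _ _) (arc_compact xy)).
  apply/seteqP; split=> // a Aa.
  have uvxy : [set u; v]%SET != [set x; y]%SET.
    apply: contraNneq ux => /setP/(_ u); rewrite !inE eqxx /= => /esym.
    by rewrite (negPf uy) orbF.
  (* A common point is a vertex, hence an end of both arcs. *)
  have [z _ za] := crossA _ _ _ _ uv xy uvxy a Aa; case: Aa; rewrite -za.
  move=> /(ends _ _ _ uv) [] -> /(ends _ _ _ xy) [] E.
  - by rewrite E eqxx in ux.
  - by rewrite E eqxx in uy.
  - by rewrite E eqxx in vx.
  - by rewrite E eqxx in vy.
(* Halved because both points will move at once, each by less than the margin. *)
by exists (d / 2) => [|a c Aa /(dP _ _ Aa)]; lra.
Qed.

Lemma outerplanar_noncrossing : exists g : T -> T -> int,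
  [/\ forall x y, g x y = - g y x,
      forall x y, x != y -> exists k, g x y = k * 2 + 1
    & noncrossing g [set: T]%SET e].
Proof.
have p_inj : injective p by case: pA.
have [M MP] := drawing_bounded; have [w Fw Mw] := outer_far M.
have pD v : D (p v) by left; exists v.
(* Since [w] is farther from the origin than the drawing, every [a - w] shares a half-plane with
   [- w]. *)
have [c [r w_far]] : exists c r, forall a, D a -> half_plane c r (a - w).
  have [c [r crP]] := half_plane_near (- w); exists c, r => a /MP aM.
  by apply: crP; rewrite opprK subrK normrN; apply: le_lt_trans Mw.
have [psi [psi_side psiE]] := half_turns_potential R c r.
have [d1 d10 /choice[t tP]] : exists2 d : R, 0 < d & forall x,
    exists t, chain (avoids (away x) d) (p x) t /\ last (p x) t = w.
  apply: uniform_small => [x d d' _ dd' [t [tP tw]]|x].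
    by exists t; split=> //; apply: sub_chain tP => a b; apply: avoids_le.
  by have [d d0 [t tP tw]] := vertex_chain x Fw; exists d => //; exists t.
have [d2 d20 d2P] : exists2 d : R, 0 < d & forall i : T * T * T * T,
    disjoint_edges i.1.1.1 i.1.1.2 i.1.2 i.2 -> forall a c,
    A [set i.1.1.1; i.1.1.2]%SET a -> A [set i.1.2; i.2]%SET c ->
    d + d <= `|a - c|.
  apply: uniform_small => [i d d' _ dd' H /H{}H a b Aa /(H a b Aa)|]; first lra.
  move=> [[[u v] x] y] /=; have [dis|ndis] := boolP (disjoint_edges u v x y).
    by have [d d0 dP] := disjoint_arcs dis; exists d.
  by exists 1.
(* [d1] serves for an arc against a chain to [w], [d2] for two disjoint arcs. *)
pose d := Num.min d1 d2.
have d0 : 0 < d by rewrite lt_min d10.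
have dd1 : d <= d1 by rewrite ge_min lexx.
have dd2 : d <= d2 by rewrite ge_min lexx orbT.
have /choice[s sP] : forall uv : T * T, exists s, e uv.1 uv.2 ->
    chain (step (A [set uv.1; uv.2]%SET) d) (p uv.1) s /\
    last (p uv.1) s = p uv.2.
  move=> [u v] /=; have [uv|nuv] := boolP (e u v); last by exists [::].
  have [Au Av] := arc_ends uv.
  by have [s sP sv] := connected_chain (arc_connected uv) d0 Au Av; exists s.
pose f x v : int := psi (p v - w) - turns (p v) (p x) (t x).
exists (fun x v => f x v - f v x); split.
- by move=> x y; rewrite [RHS]opprB.
- move=> x y xy.
  (* As [p x - p y] and its opposite have different sides, this parity makes [f x y - f y x] odd. *)
  have f_side u v : u != v -> exists k, f u v = 1 + side (p u - p v) + k * 2.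
    move=> uv; have [tu tw] := tP u.
    have Kv : away u (p v) by left; exists v; rewrite //= eq_sym.
    have [k1 K1] := turns_parity Kv d10 tu; rewrite tw in K1.
    have [k2 K2] := psi_side (p v - w).
    have wv : p v - w != 0.
      rewrite subr_eq0; apply/eqP => vw.
      by apply: (outer_avoids Fw); rewrite -vw.
    have := sideN wv; rewrite opprB => K3.
    exists (k2 - k1 - side (w - p v) - side (p u - p v)).
    by rewrite /f K1 K2 K3; ring.
  have [k1 ->] := f_side x y xy; rewrite eq_sym in xy.
  have [k2 ->] := f_side y x xy.
  have xy0 : p y - p x != 0.
    by rewrite subr_eq0; apply: contraNneq xy => /p_inj ->.
  have := sideN xy0; rewrite opprB => ->.
  by exists (k1 - k2 - side (p y - p x)); lia.
(* The square of the arc [uv] and the chain from [x] to [w]: [psi] gives its side at [w], and [f]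
   absorbs the turning of the chain about [u] and [v]. *)
have edge_square x u v : e u v -> x != u -> x != v ->
    turns (p x) (p u) (s (u, v)) = f x v - f x u.
  move=> uv xu xv; have [su sv] := sP (u, v) uv; have [tx tw] := tP x.
  have AK : A [set u; v]%SET `<=` away x by move=> z Az; right; exists (u, v).
  have AD : A [set u; v]%SET `<=` D by move=> z /AK/away_drawing.
  have sq := turns_square (fun a a' b b' H1 H2 =>
    step_avoids_square AK H1 (avoids_le dd1 H2)) su tx.
  rewrite /= in su sv sq; rewrite sv tw in sq.
  suff : turns w (p u) (s (u, v)) = psi (p v - w) - psi (p u - w).
    by rewrite /f; lia.
  rewrite -sv; elim: (s (u, v)) (p u) su => [|b l IH] a /=.
    by move=> _; rewrite subrr.
  move=> [[Aa Ab _] /IH->]; rewrite psiE; first ring.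
  - exact/w_far/AD.
  - exact/w_far/AD.
move=> x y u v _ _ _ _ xy uv xu xv yu yv /=.
have [sx sy] := sP (x, y) xy; have [su sv] := sP (u, v) uv.
have dis : disjoint_edges u v x y.
  by apply/and5P; split; rewrite // ?[u == _]eq_sym ?[v == _]eq_sym ?xv.
(* The square of the two arcs; [edge_square] expresses its four sides through [f]. *)
have sq : turns (p x) (p u) (s (u, v)) + turns (p v) (p x) (s (x, y)) =
    turns (p u) (p x) (s (x, y)) + turns (p y) (p u) (s (u, v)).
  have := turns_square _ su sx; rewrite /= in sy sv; rewrite sy sv; apply.
  move=> a a' b b' [Aa _ aa'] [Ab _ bb']; apply: near_small_square.
  have := d2P (u, v, x, y) dis a b Aa Ab; lra.
rewrite !edge_square // in sq; rewrite 1?eq_sym //.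
clearbody f; clear -sq; lia.
Qed.

End Embedding.
End Main.

Local Close Scope ring_scope.
Local Close Scope classical_set_scope.

Theorem corollary3 (R : realType) (T : finType) (e : rel T)
    (T_gt0 : 0 < #|T|) (e_sym : symmetric e) (e_irr : irreflexive e)
    (e_outer : outerplanar R e) :
  property_M e 3.
Proof.
case: e_outer => p [A [F [pA FO pF]]].
have [g [g_anti g_odd ncr]] := outerplanar_noncrossing pA FO pF.
exact: noncrossing_property_M g_anti g_odd T_gt0 e_sym e_irr ncr.
Qed.
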